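(* Let $R$ be a compact discrete valuation ring with fraction field $K$, and let $T=K/R$ with the quotient topology. Let $\mathcal{T}_R$ be the space of continuous group homomorphisms $R\to\mathbb{R}/\mathbb{Z}$ with the compact-open topology and the $R$-module structure $(r\cdot\varphi)(s)=\varphi(rs)$. Then there exists a (non-canonical) map $\mathcal{T}_R\to T$ that is both an isomorphism of $R$-modules and a homeomorphism.
   Context: A discrete valuation ring (DVR) $R$ carries the metric topology of its valuation (powers of the maximal ideal form a basis of neighborhoods of $0$); it is called compact if it is compact in this topology. Its fraction field $K$ carries the topology of the extended absolute value. *)

(* Defs.v *)
From HB Require Import structures.
From mathcomp Require Import all_boot all_order all_algebra.
From mathcomp Require Import zify.
From mathcomp Require Import generic_quotient ring_quotient fraction.
From mathcomp Require Import all_classical all_reals all_analysis.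

Set Implicit Arguments.
Unset Strict Implicit.
Unset Printing Implicit Defensive.

Import Order.TTheory GRing.Theory Num.Theory.
Import numFieldTopology.Exports numFieldNormedType.Exports.

Local Open Scope classical_set_scope.
Local Open Scope ring_scope.
Local Open Scope quotient_scope.

(* A discrete valuation ring: an integral domain R whose fraction field carries
   a surjective valuation with valuation ring R. The valuation is determined by
   R. Its value at 0, conventionally infinite, is left unspecified. *)
HB.mixin Record IntegralDomain_isDVR R of GRing.IntegralDomain R := {
  valuation : {fraction R} -> int;
  valuationM : forall x y : {fraction R}, x != 0 -> y != 0 ->
    valuation (x * y) = valuation x + valuation y;
  valuationD : forall x y : {fraction R}, x != 0 -> y != 0 -> x + y != 0 ->
    Order.min (valuation x) (valuation y) <= valuation (x + y);
  valuation_surj : forall n : int,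
    exists2 x : {fraction R}, x != 0 & valuation x = n;
  valuation_ge0P : forall x : {fraction R}, x != 0 ->
    0 <= valuation x <-> exists r : R, tofrac r = x
}.

#[short(type="dvrType")]
HB.structure Definition DVR :=
  {R of GRing.IntegralDomain R & IntegralDomain_isDVR R}.

Section AbsoluteValue.
Variable R : dvrType.
Implicit Types x y z : {fraction R}.

(* The base 2 only fixes the metric in its class: any other base > 1 gives the
   same topology. With this choice absolute values are rational numbers. *)
Definition dvr_abs x : rat := if x == 0 then 0 else 2 ^ (- valuation x).

Lemma dvr_abs0 : dvr_abs 0 = 0.
Proof. by rewrite /dvr_abs eqxx. Qed.

Lemma dvr_abs_gt0 x : x != 0 -> 0 < dvr_abs x.
Proof. by move=> /negPf x0; rewrite /dvr_abs x0 exprz_gt0. Qed.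

Lemma dvr_abs_ge0 x : 0 <= dvr_abs x.
Proof.
by have [->|/dvr_abs_gt0/ltW//] := eqVneq x 0; rewrite dvr_abs0.
Qed.

Lemma dvr_abs_eq0 x : dvr_abs x = 0 -> x = 0.
Proof.
by move=> h; apply/eqP/negPn/negP => /dvr_abs_gt0; rewrite h ltxx.
Qed.

Lemma valuation1 : valuation (1 : {fraction R}) = 0.
Proof.
apply: (@addrI _ (valuation (1 : {fraction R}))).
by rewrite addr0 -valuationM ?oner_neq0// mulr1.
Qed.

Lemma valuationN x : valuation (- x) = valuation x.
Proof.
have [->|x0] := eqVneq x 0; first by rewrite oppr0.
have N10 : -1 != 0 :> {fraction R} by rewrite oppr_eq0 oner_neq0.
rewrite -mulN1r valuationM//.
have := valuationM _ _ N10 N10; rewrite mulrNN mulr1 valuation1 => /esym/eqP.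
by rewrite -mulr2n mulrn_eq0/= => /eqP ->; rewrite add0r.
Qed.

Lemma dvr_absN x : dvr_abs (- x) = dvr_abs x.
Proof. by rewrite /dvr_abs oppr_eq0 valuationN. Qed.

Lemma dvr_absM x y : dvr_abs (x * y) = dvr_abs x * dvr_abs y.
Proof.
rewrite /dvr_abs mulf_eq0; case: eqVneq => [|x0]/=; first by rewrite mul0r.
case: eqVneq => [|y0]/=; first by rewrite mulr0.
by rewrite valuationM// opprD expfzDr.
Qed.

Lemma dvr_abs_ultra x y :
  dvr_abs (x + y) <= Order.max (dvr_abs x) (dvr_abs y).
Proof.
have [->|x0] := eqVneq x 0; first by rewrite add0r le_max lexx orbT.
have [->|y0] := eqVneq y 0; first by rewrite addr0 le_max lexx.
have [->|xy0] := eqVneq (x + y) 0.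
  by rewrite dvr_abs0 le_max dvr_abs_ge0.
rewrite /dvr_abs (negPf x0) (negPf y0) (negPf xy0) le_max.
by rewrite !ler_eXz2l ?ltr1n// !lerN2 -ge_min valuationD.
Qed.

Lemma dvr_abs_triangle x y : dvr_abs (x + y) <= dvr_abs x + dvr_abs y.
Proof.
apply: le_trans (dvr_abs_ultra x y) _.
by rewrite ge_max lerDl lerDr !dvr_abs_ge0.
Qed.

Let fdist x y := dvr_abs (x - y).

Let fdistxx x : fdist x x = 0.
Proof. by rewrite /fdist subrr dvr_abs0. Qed.

Let fdist_positivity x y : fdist x y = 0 -> x = y.
Proof. by move=> /dvr_abs_eq0/eqP; rewrite subr_eq0 => /eqP. Qed.

Let fdist_sym x y : fdist x y = fdist y x.
Proof. by rewrite /fdist -dvr_absN opprB. Qed.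

Let fdist_triangle y x z : fdist x z <= fdist x y + fdist y z.
Proof. by rewrite /fdist -[x - z](subrKA y) dvr_abs_triangle. Qed.

HB.instance Definition _ := isMetric.Build rat {fraction R}
  fdistxx fdist_positivity fdist_sym fdist_triangle.

Lemma frac_mdistE x y : mdist x y = dvr_abs (x - y).
Proof. by []. Qed.

End AbsoluteValue.

(* The ring R itself, with the metric topology of its valuation. *)
Definition adic (R : dvrType) : Type := R.

Section Adic.
Variable R : dvrType.
Local Notation "x %:F" := (@tofrac R x).

HB.instance Definition _ := DVR.copy (adic R) R.

Let adist (x y : adic R) := dvr_abs (x%:F - y%:F).

Let adistxx x : adist x x = 0.
Proof. by rewrite /adist subrr dvr_abs0. Qed.

Let adist_positivity x y : adist x y = 0 -> x = y.
Proof.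
by move=> /dvr_abs_eq0/eqP; rewrite subr_eq0 tofrac_eq => /eqP.
Qed.

Let adist_sym x y : adist x y = adist y x.
Proof. by rewrite /adist -dvr_absN opprB. Qed.

Let adist_triangle y x z : adist x z <= adist x y + adist y z.
Proof. by rewrite /adist -[x%:F - _](subrKA y%:F) dvr_abs_triangle. Qed.

HB.instance Definition _ := isMetric.Build rat (adic R)
  adistxx adist_positivity adist_sym adist_triangle.

Lemma adic_mdistE (x y : adic R) : mdist x y = dvr_abs (x%:F - y%:F).
Proof. by []. Qed.

(* The powers of the maximal ideal, generated by any uniformizer p, form a
   basis of neighborhoods. *)
Lemma nbhs_adicP (p x : R) (A : set (adic R)) :
  p != 0 -> valuation p%:F = 1 ->
  nbhs (x : adic R) A <-> exists n : nat, forall s : R, A (x + p ^+ n * s).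
Proof.
move=> p0 vp; have p0' : p%:F != 0 :> {fraction R} by rewrite tofrac_eq0.
have ap n : dvr_abs (p%:F ^+ n) = 2^-1 ^+ n.
  elim: n => [|n IHn]; last first.
    by rewrite !exprS dvr_absM IHn /dvr_abs (negPf p0') vp.
  by rewrite !expr0 /dvr_abs oner_eq0 valuation1.
have ale1 (s : R) : dvr_abs (s%:F) <= 1.
  have [->|s0] := eqVneq s 0; first by rewrite tofrac0 dvr_abs0.
  have s0' : s%:F != 0 :> {fraction R} by rewrite tofrac_eq0.
  rewrite /dvr_abs (negPf s0') -(expr0z (2 : rat)) ler_eXz2l ?ltr1n//.
  by rewrite oppr_le0; apply/valuation_ge0P => //; exists s.
split=> [/nbhs_ballP[e /= e0 eA]|[n An]].
  have [n ne] : exists n, 2^-1 ^+ n < e.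
    have := @Num.Theory.archi_boundP _ e^-1.
    rewrite invr_ge0 ltW// => /(_ isT) bnd; exists (Num.bound e^-1).
    rewrite exprVn invf_plt ?posrE ?exprn_gt0//.
    apply: lt_le_trans bnd _; rewrite -natrX ler_nat ltnW//.
    exact: ltn_expl.
  exists n => s; apply: eA; rewrite ballEmdist/= adic_mdistE.
  rewrite tofracD opprD addrA subrr add0r dvr_absN tofracM tofracXn dvr_absM.
  by rewrite ap; apply: le_lt_trans ne; rewrite ler_piMr// exprn_ge0.
apply/nbhs_ballP; exists (2^-1 ^+ n * 2).
  by rewrite /= mulr_gt0// exprn_gt0.
move=> y; rewrite ballEmdist/= adic_mdistE => xy.
have [->|yx] := eqVneq y x; first by have := An 0; rewrite mulr0 addr0.
have yx0 : (y - x)%:F != 0 :> {fraction R} by rewrite tofrac_eq0 subr_eq0.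
have pn0 : p%:F ^+ n != 0 :> {fraction R} by rewrite expf_neq0.
pose q : {fraction R} := (y - x)%:F / p%:F ^+ n.
have q0 : q != 0 by rewrite mulf_neq0// invr_neq0.
have qE : (y - x)%:F = q * p%:F ^+ n :> {fraction R} by rewrite /q divfK.
have /(valuation_ge0P _ q0)[s sq] : 0 <= valuation q.
  have : dvr_abs q < 2 ^ 1.
    move: xy; rewrite -dvr_absN opprB -tofracB qE dvr_absM ap mulrC.
    by rewrite ltr_pM2l// exprn_gt0.
  by rewrite /dvr_abs (negPf q0) ltr_eXz2l ?ltr1n//; lia.
have -> : y = x + p ^+ n * s; last exact: An.
apply/eqP; rewrite [x + _]addrC -subr_eq -tofrac_eq qE tofracM tofracXn -sq.
by rewrite mulrC.
Qed.

End Adic.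

Section FracTopologicalGroup.
Variable R : dvrType.

Lemma frac_sub_continuous :
  continuous (fun x : {fraction R} * {fraction R} => x.1 - x.2).
Proof.
move=> [x y] A /nbhs_ballP[e /= e0 eA].
exists (ball x e, ball y e); first by split; exact: nbhsx_ballx.
move=> [x' y'] [] /=; rewrite !ballEmdist /= !frac_mdistE => xx' yy'.
apply: eA; rewrite ballEmdist /= frac_mdistE.
have -> : x - y - (x' - y') = (x - x') + (- (y - y')).
  by rewrite !opprB addrACA [RHS]addrACA [- y - x']addrC.
by apply: le_lt_trans (dvr_abs_ultra _ _) _; rewrite gt_max dvr_absN xx' yy'.
Qed.

HB.instance Definition _ :=
  PreTopologicalNmodule_isTopologicalZmodule.Build {fraction R}
    frac_sub_continuous.

End FracTopologicalGroup.

(* The quotient group V / H with the quotient topology. *)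
Section TopologicalQuotient.
Variables (V : topologicalZmodType) (H : zmodClosed V).
Implicit Types x y : V.

Definition topquot : Type := quotient_topology (@Quotient.quot V H).

HB.instance Definition _ := Topological.on topquot.
HB.instance Definition _ := Quotient.on topquot.
HB.instance Definition _ := GRing.isZmodule.Build topquot
  (@Quotient.addqA V H) (@Quotient.addqC V H) (@Quotient.add0q V H)
  (@Quotient.addNq V H).

Lemma topquot_piD x y : \pi_topquot (x + y) = \pi x + \pi y.
Proof. exact: (@Quotient.pi_add V H x y). Qed.

Lemma topquot_piN x : \pi_topquot (- x) = - \pi x.
Proof. exact: (@Quotient.pi_opp V H x). Qed.

Lemma topquot_piE x y : (\pi_topquot x = \pi y) <-> x - y \in H.
Proof. by rewrite Quotient.idealrBE; split=> [e|/eqP//]; apply/eqP. Qed.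

Lemma topquot_pi_continuous : continuous (\pi_topquot : V -> topquot).
Proof. exact: pi_continuous. Qed.

Lemma addl_continuous x : continuous (fun y : V => x + y).
Proof.
move=> y; apply: (@continuous_comp _ (V * V)%type _ (fun y => (x, y))
  (fun z : V * V => z.1 + z.2)); last exact: add_continuous.
by apply: cvg_pair; [exact: cvg_cst|exact: cvg_id].
Qed.

Lemma topquot_pi_open (A : set V) :
  open A -> open (\pi_topquot @` A : set topquot).
Proof.
move=> oA; rewrite /open/= /quotient_open.
have -> : \pi_topquot @^-1` (\pi_topquot @` A) =
    \bigcup_(h in [set h | h \in H]) ((fun y => h + y) @^-1` A).
  apply/seteqP; split=> x /=.
    move=> [y Ay] /topquot_piE yx; exists (y - x) => //=; by rewrite subrK.
  move=> [h /= hH Ahx]; exists (h + x) => //; apply/topquot_piE.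
  by rewrite addrK.
by apply: bigcup_open => h _; move/continuousP: (@addl_continuous h); apply.
Qed.

Lemma topquot_pi_nbhs x (A : set V) :
  nbhs x A -> nbhs (\pi_topquot x) (\pi_topquot @` A).
Proof.
rewrite nbhsE => -[B [oB Bx] BA]; apply: (@filterS _ _ _ (\pi_topquot @` B)).
  exact: image_subset.
by apply: open_nbhs_nbhs; split; [exact: topquot_pi_open|exists x].
Qed.

Lemma topquot_sub_continuous :
  continuous (fun z : topquot * topquot => z.1 - z.2).
Proof.
move=> [a b] A /=; rewrite -[a]reprK -[b]reprK -topquot_piN -topquot_piD.
move=> /topquot_pi_continuous/(@sub_continuous V (repr a, repr b)).
move=> [[B C] [/= nB nC] BCA].
exists (\pi_topquot @` B, \pi_topquot @` C).
  by split; exact: topquot_pi_nbhs.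
move=> [_ _] [/= [x Bx <-] [y Cy <-]].
by rewrite -topquot_piN -topquot_piD; exact: (BCA (x, y)).
Qed.

HB.instance Definition _ :=
  PreTopologicalNmodule_isTopologicalZmodule.Build topquot
    topquot_sub_continuous.

End TopologicalQuotient.

(* R / Z, for an arbitrary model RR of the real numbers; Num.int_num_subdef is
   the predicate underlying Num.int. *)
Definition circle (RR : realType) : Type :=
  topquot (GRing.ZmodClosed.clone RR (@Num.int_num_subdef RR) _).

HB.instance Definition _ (RR : realType) := TopologicalZmodule.on (circle RR).

Section FracQuotient.
Variable R : dvrType.
Local Notation "x %:F" := (@tofrac R x).

Definition integral_frac : {pred {fraction R}} :=
  fun x => `[< exists r : R, r%:F = x >].

Lemma integral_frac_zmod_closed : zmod_closed integral_frac.
Proof.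
split; first by apply/asboolP; exists 0; rewrite tofrac0.
move=> x y /asboolP[r <-] /asboolP[s <-]; apply/asboolP.
by exists (r - s); rewrite tofracB.
Qed.

HB.instance Definition _ :=
  GRing.isZmodClosed.Build {fraction R} integral_frac
    integral_frac_zmod_closed.

(* K / R, where K is the fraction field of R. *)
Definition frac_quot : Type :=
  topquot (GRing.ZmodClosed.clone {fraction R} integral_frac _).

HB.instance Definition _ := TopologicalZmodule.on frac_quot.
HB.instance Definition _ := Quotient.on frac_quot.

Definition frac_quot_scale (r : R) (t : frac_quot) : frac_quot :=
  \pi_frac_quot (r%:F * repr t).

Lemma frac_quot_scale_pi (r : R) (x : {fraction R}) :
  frac_quot_scale r (\pi_frac_quot x) = \pi_frac_quot (r%:F * x).
Proof.
apply/topquot_piE; rewrite -mulrBr.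
have /topquot_piE/asboolP[s es] :
  \pi_frac_quot (repr (\pi_frac_quot x)) = \pi_frac_quot x by exact: reprK.
by apply/asboolP; exists (r * s); rewrite tofracM es.
Qed.

Let scaleA r s t :
  frac_quot_scale r (frac_quot_scale s t) = frac_quot_scale (r * s) t.
Proof.
elim/quotW: t => x.
by rewrite (frac_quot_scale_pi s x) !frac_quot_scale_pi tofracM mulrA.
Qed.

Let scale1 : left_id 1 frac_quot_scale.
Proof. by elim/quotW => x; rewrite frac_quot_scale_pi tofrac1 mul1r. Qed.

Let scaleDr : right_distributive frac_quot_scale +%R.
Proof.
move=> r; elim/quotW => x; elim/quotW => y.
by rewrite -topquot_piD !frac_quot_scale_pi mulrDr topquot_piD.
Qed.

Let scaleDl t : {morph frac_quot_scale^~ t : r s / r + s}.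
Proof.
move=> r s; elim/quotW: t => x.
by rewrite !frac_quot_scale_pi tofracD mulrDl topquot_piD.
Qed.

HB.instance Definition _ := GRing.Zmodule_isLmodule.Build R frac_quot
  scaleA scale1 scaleDr scaleDl.

Lemma frac_quot_scaleE (r : R) (x : {fraction R}) :
  r *: (\pi_frac_quot x : frac_quot) = \pi_frac_quot (r%:F * x).
Proof. exact: frac_quot_scale_pi. Qed.

End FracQuotient.

Section Dual.
Variables (RR : realType) (R : dvrType).
Local Notation "x %:F" := (@tofrac R x).
Local Notation C := (circle RR).

Definition characters : set {compact-open, adic R -> C} :=
  [set f | continuous f /\ {morph f : x y / x + y}].

(* As a set type, it carries the topology induced by the compact-open one. *)
Definition pdual : Type := characters.

HB.instance Definition _ := Topological.on pdual.

Definition pdual_fun (f : pdual) : adic R -> C := \val f.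
Coercion pdual_fun : pdual >-> Funclass.

Lemma pdual_continuous (f : pdual) : continuous f.
Proof. by have [] := set_mem (valP f). Qed.

Lemma pdualD (f : pdual) : {morph f : x y / x + y}.
Proof. by have [] := set_mem (valP f). Qed.

Definition mkdual (f : adic R -> C) (cf : continuous f)
  (Df : {morph f : x y / x + y}) : pdual :=
  exist _ (f : {compact-open, adic R -> C}) (mem_set (conj cf Df)).

Lemma pdualP (f g : pdual) : f =1 g -> f = g.
Proof. by move=> fg; apply/val_inj/funext. Qed.

Lemma pdual0_subproof : continuous (fun _ : adic R => 0 : C) /\
  {morph (fun _ : adic R => 0 : C) : x y / x + y}.
Proof. by split=> [|x y]; [exact: cst_continuous|rewrite /= addr0]. Qed.

Definition pdual0 : pdual := mkdual pdual0_subproof.1 pdual0_subproof.2.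

Lemma pdualN_subproof (f : pdual) : continuous (fun x : adic R => - f x) /\
  {morph (fun x : adic R => - f x) : x y / x + y}.
Proof.
split=> [x|x y]; last by rewrite pdualD opprD.
by apply: continuous_comp; [exact: pdual_continuous|exact: opp_continuous].
Qed.

Definition pdual_opp (f : pdual) : pdual :=
  mkdual (pdualN_subproof f).1 (pdualN_subproof f).2.

Lemma pdualD_subproof (f g : pdual) :
  continuous (fun x : adic R => f x + g x) /\
  {morph (fun x : adic R => f x + g x) : x y / x + y}.
Proof.
split=> [x|x y]; last by rewrite !pdualD addrACA.
apply: (@continuous_comp _ (C * C)%type _ (fun x => (f x, g x))
  (fun z : C * C => z.1 + z.2)); last exact: add_continuous.
apply: (@cvg_pair _ _ _ (nbhs x) (nbhs (f x)) (nbhs (g x)));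
  exact: pdual_continuous.
Qed.

Definition pdual_add (f g : pdual) : pdual :=
  mkdual (pdualD_subproof f g).1 (pdualD_subproof f g).2.

Let addA : associative pdual_add.
Proof. by move=> f g h; apply: pdualP => x; exact: addrA. Qed.

Let addC : commutative pdual_add.
Proof. by move=> f g; apply: pdualP => x; exact: addrC. Qed.

Let add0 : left_id pdual0 pdual_add.
Proof. by move=> f; apply: pdualP => x; exact: add0r. Qed.

Let addN : left_inverse pdual0 pdual_opp pdual_add.
Proof. by move=> f; apply: pdualP => x; exact: addNr. Qed.

HB.instance Definition _ := GRing.isZmodule.Build pdual addA addC add0 addN.

Lemma adic_mul_continuous (r : adic R) : continuous (fun s : adic R => r * s).
Proof.
move=> s A /nbhs_ballP[e /= e0 eA]; apply/nbhs_ballP.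
move: eA; have [->|r0] := eqVneq r 0.
  move=> eA; exists 1 => //= t _; apply: eA.
  by rewrite !mul0r; exact: ballxx.
move=> eA; have ar0 : 0 < dvr_abs (r%:F).
  by rewrite dvr_abs_gt0// tofrac_eq0.
exists (e / dvr_abs (r%:F)); first by rewrite /= divr_gt0.
move=> t; rewrite ballEmdist/= adic_mdistE ltr_pdivlMr// => st.
apply: eA; rewrite ballEmdist/= adic_mdistE !tofracM -mulrBr dvr_absM.
by rewrite mulrC.
Qed.

Lemma pdualZ_subproof (r : R) (f : pdual) :
  continuous (fun s : adic R => f ((r : adic R) * s)) /\
  {morph (fun s : adic R => f ((r : adic R) * s)) : x y / x + y}.
Proof.
split=> [s|x y]; last by rewrite mulrDr pdualD.
apply: (@continuous_comp _ _ _ (fun s : adic R => (r : adic R) * s) f).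
  exact: adic_mul_continuous.
exact: pdual_continuous.
Qed.

Definition pdual_scale (r : R) (f : pdual) : pdual :=
  mkdual (pdualZ_subproof r f).1 (pdualZ_subproof r f).2.

Let scaleA r s f : pdual_scale r (pdual_scale s f) = pdual_scale (r * s) f.
Proof. by apply: pdualP => x /=; congr (f _); rewrite mulrCA mulrA. Qed.

Let scale1 : left_id 1 pdual_scale.
Proof. by move=> f; apply: pdualP => x; congr (f _); exact: mul1r. Qed.

Let scaleDr : right_distributive pdual_scale +%R.
Proof. by move=> r f g; exact: pdualP. Qed.

Let scaleDl f : {morph pdual_scale^~ f : r s / r + s}.
Proof.
move=> r s; apply: pdualP => x; apply: etrans (pdualD f _ _).
by congr (f _); exact: mulrDl.
Qed.

HB.instance Definition _ := GRing.Zmodule_isLmodule.Build R pdual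
  scaleA scale1 scaleDr scaleDl.

Lemma pdual_addE (f g : pdual) (x : adic R) : (f + g : pdual) x = f x + g x.
Proof. by []. Qed.

Lemma pdual_scaleE (r : R) (f : pdual) (s : adic R) :
  (r *: f : pdual) s = f ((r : adic R) * s).
Proof. by []. Qed.

End Dual.

(* Main.v *)
From HB Require Import structures.
Require Import Defs.
From mathcomp Require Import all_boot all_order all_algebra.
From mathcomp Require Import zify lra.
From mathcomp Require Import generic_quotient fraction.
From mathcomp Require Import all_classical all_reals all_analysis.
From mathcomp Require Import complex.

Set Implicit Arguments.
Unset Strict Implicit.
Unset Printing Implicit Defensive.

Import Order.TTheory GRing.Theory Num.Theory.
Local Open Scope classical_set_scope.
Local Open Scope ring_scope.
Local Open Scope quotient_scope.

(** Let p be a uniformizer of R. Both sides are discrete: K / R because R is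
    open in K, and the dual because R is compact and the circle has no small
    subgroups. So any R-linear bijection between them is a homeomorphism, and
    only an algebraic isomorphism has to be found.

    Every nonzero element of K / R has the class of 1 / p among its multiples.
    The circle is divisible and has torsion of every order, so Zorn's lemma
    yields an additive map psi from K / R to the circle that does not vanish on
    the class of 1 / p (separating_hom); hence no nonzero R-submodule of K / R
    lies in the kernel of psi. The choice of psi is what makes the isomorphism
    non-canonical. It sends t to the character s |-> psi (s t), which is
    continuous because t is killed by a power of p, and it is injective because
    the multiples of a nonzero t are not all in the kernel of psi.

    For surjectivity, a character phi vanishes on some ideal p^n R, since it
    maps a small enough one into an arc that contains no nonzero subgroup
    (character_conductor). The pairing (a, x) |-> psi (a x / p^n) on the finite
    ring R / p^n is nondegenerate. Let e be the embedding of the circle into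
    the complex numbers. Summing over a first, the orthogonality of characters
    reduces the double sum over a and x of e (phi x - psi (a x / p^n)) to the
    terms with x = 0, so that it equals the order of R / p^n. For some a the
    sum over x is then nonzero, and this forces the character
    x |-> phi x - psi (a x / p^n) to be trivial (perfect_pairing): phi is the
    image of the class of a / p^n. *)

(** * Maps between groups and spaces *)

Lemma additive0 (G D : zmodType) (f : G -> D) :
  {morph f : x y / x + y} -> f 0 = 0.
Proof. by move=> fD; apply: (addrI (f 0)); rewrite -fD !addr0. Qed.

Lemma additiveMn (G D : zmodType) (f : G -> D) x n :
  {morph f : x y / x + y} -> f (x *+ n) = f x *+ n.
Proof.
move=> fD; elim: n => [|n IHn]; first by rewrite !mulr0n additive0.
by rewrite !mulrS fD IHn.
Qed.

Lemma discrete_continuous (T U : topologicalType) (f : T -> U) :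
  (forall t : T, nbhs t [set t]) -> continuous f.
Proof.
move=> dT t A nA; apply: filterS (dT t) => _ ->; exact: nbhs_singleton nA.
Qed.

Lemma nbhs_all_seq (T : topologicalType) (I : eqType) (t : T) (s : seq I)
    (Q : I -> set T) :
  (forall i, nbhs t (Q i)) -> nbhs t [set u | {in s, forall i, Q i u}].
Proof.
move=> nQ; elim: s => [|i s IHs]; first exact: filterS filterT.
apply: filterS2 (nQ i) IHs => u Qi Qs j; rewrite inE => /orP[/eqP -> //|].
exact: Qs.
Qed.

(** * Extending homomorphisms into divisible groups *)

Section DivisibleExtension.
Variables (G D : zmodType).
Implicit Types (S B : set (G * D)).

(** The graph of a homomorphism to D from a subgroup of G, encoded as a
    subgroup of the product so that extending a homomorphism is plain
    inclusion of sets. *)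
Definition partial_hom S :=
  [/\ S 0, forall u v, S u -> S v -> S (u - v) & forall d, S (0, d) -> d = 0].

Lemma partial_homN S u : partial_hom S -> S u -> S (- u).
Proof. by move=> [S0 SB _] Su; rewrite -sub0r; exact: SB. Qed.

Lemma partial_homD S u v : partial_hom S -> S u -> S v -> S (u + v).
Proof.
move=> hS Su Sv; have [_ SB _] := hS; rewrite -[v]opprK; apply: SB => //.
exact: partial_homN.
Qed.

Lemma partial_homMn S u n : partial_hom S -> S u -> S (u *+ n).
Proof.
move=> hS Su; have [S0 _ _] := hS.
elim: n => [|n IHn]; first by rewrite mulr0n.
by rewrite mulrS; exact: partial_homD.
Qed.

Lemma partial_hom_fun S x d e : partial_hom S -> S (x, d) -> S (x, e) -> d = e.
Proof.
move=> [_ SB S0] Sd Se; apply/eqP; rewrite -subr_eq0; apply/eqP/S0.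
by have := SB _ _ Sd Se; rewrite -(subrr x).
Qed.

Lemma pair_mulrn (x : G) (d : D) n : (x, d) *+ n = (x *+ n, d *+ n).
Proof. by elim: n => // n IHn; rewrite !mulrS IHn. Qed.

Lemma pair_sub (x y : G) (d e : D) : (x, d) - (y, e) = (x - y, d - e).
Proof. by []. Qed.

Lemma pair_add (x y : G) (d e : D) : (x, d) + (y, e) = (x + y, d + e).
Proof. by []. Qed.

(** The condition under which mapping x to d agrees with S on the multiples of x
    that already lie in its domain. *)
Definition compatible_value S x d := forall n e, S (x *+ n, e) -> d *+ n = e.

Definition adjoin_graph S x d : set (G * D) :=
  [set u | exists m : int, S (u - (x, d) *~ m)].

Lemma adjoin_partial_hom S x d : partial_hom S -> compatible_value S x d ->
  partial_hom (adjoin_graph S x d).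
Proof.
move=> hS xd; have [S0 SB SF] := hS; split.
- by exists 0; rewrite mulr0z subr0.
- move=> u v [m Su] [k Sv]; exists (m - k).
  rewrite mulrzBr.
  have -> (a b c d' : G * D) : a - b - (c - d') = (a - c) - (b - d').
    by rewrite !opprD !opprK addrACA.
  exact: SB.
- move=> c [[n|n]]; rewrite ?NegzE ?mulrNz ?opprK -pmulrn pair_mulrn => Sc.
  + have /= := partial_homN hS Sc.
    rewrite opprB => {}Sc.
    have {Sc}/xd/eqP : S (x *+ n, d *+ n - c).
      by rewrite pair_sub subr0 in Sc.
    by rewrite eq_sym subr_eq addrC -subr_eq subrr => /eqP.
  + have {Sc}/xd/eqP : S (x *+ n.+1, d *+ n.+1 + c).
      by rewrite pair_add add0r [c + _]addrC in Sc.
    by rewrite -subr_eq0 opprD addrA subrr sub0r oppr_eq0 => /eqP.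
Qed.

Hypothesis D_divisible : forall (d : D) n, (0 < n)%N -> exists e, e *+ n = d.

(** The positive multiples of x in the domain of S, if any, are those of n x for
    the least possible n, so d only has to solve n d = S (n x), which is where
    divisibility enters. *)
Lemma compatible_value_exists S (x : G) : partial_hom S ->
  exists d, compatible_value S x d.
Proof.
move=> hS; have [S0 SB SF] := hS.
pose P n := `[< (0 < n)%N /\ exists e, S (x *+ n, e) >].
have [exP|noP] := pselect (exists n, P n); last first.
  exists 0 => -[|n] e Se; first by rewrite (SF e).
  by exfalso; apply: noP; exists n.+1; apply/asboolP; split=> //; exists e.
case: (ex_minnP exP) => n /asboolP[n0 [e Se]] nmin.
have [d de] := D_divisible e n0; exists d => m e' Se'.
have Sr : S (x *+ (m %% n)%N, e' - e *+ (m %/ n)%N).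
  have := SB _ _ Se' (partial_homMn (m %/ n)%N hS Se).
  rewrite pair_mulrn; congr (S (_, _)) => /=.
  by rewrite {1}(divn_eq m n) mulrnDr -mulrnA mulnC addrAC subrr add0r.
have r0 : (m %% n = 0)%N.
  apply/eqP; rewrite -leqn0 leqNgt; apply/negP => r0.
  have /nmin : P (m %% n)%N by apply/asboolP; split=> //; eexists; exact: Sr.
  by rewrite leqNgt ltn_mod n0.
move: Sr; rewrite r0 mulr0n => /SF/eqP; rewrite subr_eq0 => /eqP ->.
by rewrite {1}(divn_eq m n) r0 addn0 mulnC mulrnA de.
Qed.

(** Divisible groups are injective: a maximal extension of S is defined
    everywhere, since one more element could always be adjoined. *)
Lemma extend_partial_hom S : partial_hom S ->
  exists h : G -> D, {morph h : x y / x + y} /\ forall x d, S (x, d) -> h x = d.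
Proof.
move=> hS; have [S0 SB SF] := hS.
(* The union with S makes the empty chain admissible. *)
have [F FP Ftot|A [hA Amax]] := @Zorn_bigcup _ [set B | partial_hom (B `|` S)].
  split=> [|u v Fu Fv|d [[X FX Xd]|]].
  - by right.
  - have [X XF [Xu Xv]] : exists2 X,
        partial_hom (X `|` S) /\ (X `<=` \bigcup_(Y in F) Y) &
        (X `|` S) u /\ (X `|` S) v.
      case: Fu => [[X FX Xu]|Su]; case: Fv => [[Y FY Yv]|Sv].
      + have [XY|YX] := Ftot _ _ FX FY.
          exists Y; first by split; [exact: FP|exact: bigcup_sup].
          by split; left; [exact: XY|].
        exists X; first by split; [exact: FP|exact: bigcup_sup].
        by split; left; [|exact: YX].
      + exists X; first by split; [exact: FP|exact: bigcup_sup].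
        by split; [left|right].
      + exists Y; first by split; [exact: FP|exact: bigcup_sup].
        by split; [right|left].
      + by exists set0; rewrite set0U; split=> // ? [].
    have [[_ XB _] XF'] := XF; have [/XF'|] := XB _ _ Xu Xv; first by left.
    by right.
  - by have [_ _ XF] := FP _ FX; apply: XF; left.
  - exact: SF.
set M := A `|` S in hA; have [M0 _ _] := hA.
have dom x : exists d, M (x, d).
  have [d xd] := compatible_value_exists x hA.
  have hB := adjoin_partial_hom hA xd.
  set B := adjoin_graph M x d in hB.
  have MB' : M `<=` B by move=> u Mu; exists 0; rewrite mulr0z subr0.
  have Bxd : B (x, d) by exists 1; rewrite mulr1z subrr.
  exists d; apply: contrapT => nMxd.
  have BS : B `|` S = B.
    by apply/setUidPl => u Su; apply: MB'; right.
  apply: (Amax B); last by rewrite /= BS.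
  split=> [u Au|BA]; first by apply: MB'; left.
  by apply: nMxd; left; exact: BA.
have [h hM] := choice dom; exists h; split.
  move=> x y; apply: (partial_hom_fun hA (hM (x + y))).
  exact: partial_homD hA (hM x) (hM y).
by move=> x d Sxd; apply: (partial_hom_fun hA (hM x)); right.
Qed.

(** The cyclic group generated by a, of order n or infinite, is mapped to an
    element of D that n kills, or to an arbitrary torsion element; then this
    homomorphism is extended to G. *)
Lemma separating_hom (a : G) :
  (forall n, (1 < n)%N -> exists2 d : D, d != 0 & d *+ n = 0) ->
  a != 0 ->
  exists2 h : G -> D, {morph h : x y / x + y} & h a != 0.
Proof.
move=> tors a0.
have [d d0 ad] : exists2 d : D, d != 0 & forall n, a *+ n = 0 -> d *+ n = 0.
  pose P n := (0 < n)%N && (a *+ n == 0).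
  have [exP|noP] := pselect (exists n, P n); last first.
    have [d d0 _] := tors 2%N isT; exists d => // -[//|n] an.
    by exfalso; apply: noP; exists n.+1; apply/andP; split=> //; apply/eqP.
  case: (ex_minnP exP) => n /andP[n0 /eqP an] nmin.
  have n1 : (1 < n)%N.
    case: n n0 an {nmin} => [|[|n]]// _.
    by rewrite mulr1n => /eqP; rewrite (negPf a0).
  have [d d0 dn] := tors _ n1; exists d => // m am.
  have r0 : (m %% n = 0)%N.
    apply/eqP; rewrite -leqn0 leqNgt; apply/negP => r0.
    have /nmin : P (m %% n)%N.
      rewrite /P r0; apply/eqP; move: am.
      by rewrite {1}(divn_eq m n) mulrnDr mulnC mulrnA an mul0rn add0r.
    by rewrite leqNgt ltn_mod n0.
  by rewrite (divn_eq m n) r0 addn0 mulnC mulrnA dn mul0rn.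
have h0 : partial_hom [set 0 : G * D].
  by split=> [//|u v -> ->|e [//]]; rewrite subr0.
have cd : compatible_value [set 0 : G * D] a d by move=> n e [/ad -> ->].
have [h [hD hS]] := extend_partial_hom (adjoin_partial_hom h0 cd).
exists h => //; rewrite (hS a d)//.
by exists 1; rewrite mulr1z subrr.
Qed.

End DivisibleExtension.

(** * The circle group *)

Section Circle.
Variable RR : realType.
Implicit Types (t : RR) (c : circle RR).

Definition angle t : circle RR :=
  \pi_(topquot (GRing.ZmodClosed.clone RR (@Num.int_num_subdef RR) _)) t.

Lemma angleD t u : angle (t + u) = angle t + angle u.
Proof. exact: topquot_piD. Qed.

Lemma angle_eq t u : angle t = angle u <-> t - u \is a Num.int.
Proof. exact: topquot_piE. Qed.

Lemma angle0 : angle 0 = 0.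
Proof. exact: additive0 angleD. Qed.

Lemma angle_eq0 t : angle t = 0 <-> t \is a Num.int.
Proof. by rewrite -angle0 angle_eq subr0. Qed.

Lemma angleMn t n : angle (t *+ n) = angle t *+ n.
Proof. exact: additiveMn angleD. Qed.

(** A discontinuous section of the projection onto the circle. *)
Definition lift c : RR :=
  repr (c : topquot (GRing.ZmodClosed.clone RR (@Num.int_num_subdef RR) _)).

Lemma liftK c : angle (lift c) = c.
Proof. exact: reprK. Qed.

Lemma circle_divisible c n : (0 < n)%N -> exists d, d *+ n = c.
Proof.
move=> n0; exists (angle (lift c / n%:R)).
by rewrite -angleMn -[X in angle X]mulr_natr divfK ?liftK// pnatr_eq0 -lt0n.
Qed.

Lemma circle_torsion n :
  (1 < n)%N -> exists2 d : circle RR, d != 0 & d *+ n = 0.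
Proof.
move=> n1; have n0 : 0 < n%:R :> RR by rewrite ltr0n (ltn_trans _ n1).
exists (angle n%:R^-1); last first.
  rewrite -angleMn -[X in angle X]mulr_natr mulVf ?gt_eqF//.
  by apply/angle_eq0/int_num1.
apply/eqP => /angle_eq0/intrP[m me].
have : (0 < (n%:R^-1 : RR) < 1)%R by rewrite invr_gt0 n0 invf_lt1// ltr1n.
by rewrite me ltr0z ltrz1 => /andP[m0]; rewrite ltNge -gtz0_ge1 m0.
Qed.

Definition cis t : RR[i] := Complex (cos (pi *+ 2 * t)) (sin (pi *+ 2 * t)).

Lemma cisD t u : cis (t + u) = cis t * cis u.
Proof.
by apply/eqP; rewrite eq_complex /= mulrDr cosD sinD [sin _ * _ + _]addrC !eqxx.
Qed.

Lemma cis0 : cis 0 = 1.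
Proof. by rewrite /cis mulr0 cos0 sin0. Qed.

Lemma cis_int t : t \is a Num.int -> cis t = 1.
Proof.
have cisn n : cis n%:R = 1.
  elim: n => [|n IHn]; first exact: cis0.
  by rewrite -natr1 cisD IHn mul1r /cis mulr1 cos2pi sin2pi.
move=> /intrP[[n|n] ->]; first exact: cisn.
by rewrite NegzE mulrNz -[LHS]mul1r -{1}(cisn n.+1) -cisD subrr cis0.
Qed.

(** After reduction to 0 <= t < 1, the duplication formula turns
    cos (2 pi t) = 1 into sin (pi t) = 0, while the sine is positive on the open
    interval from 0 to pi. *)
Lemma cis_eq1 t : cis t = 1 -> t \is a Num.int.
Proof.
have int_fl : (Num.floor t)%:~R \is a @Num.int RR by exact: intr_int.
rewrite -(subrK (Num.floor t)%:~R t) cisD [X in _ * X]cis_int// mulr1.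
set u := t - _; have u0 : 0 <= u < 1.
  by have /andP[? ?] := floor_itv t; rewrite subr_ge0 ltrBlDl;
    apply/andP; split; rewrite // -intrD1.
move=> [cu _]; suff -> : u = 0 by rewrite add0r.
apply/eqP; apply: contraT => un0.
have : 0 < sin (pi * u).
  apply: sin_gt0_pi; case/andP: u0 => u0 u1.
  have pi0 := pi_gt0 RR; apply/andP; split.
    by rewrite mulr_gt0// lt_def un0.
  by rewrite -[X in _ < X]mulr1 ltr_pM2l.
move: cu; rewrite mulrnAl -mulrnAr mulrnAr cos_mulr2n cos2sin2 => cu.
have : sin (pi * u) ^+ 2 = 0 by lra.
by move/eqP; rewrite sqrf_eq0 => /eqP ->; rewrite ltxx.
Qed.

Definition circle_exp c : RR[i] := cis (lift c).

Lemma circle_expD c d : circle_exp (c + d) = circle_exp c * circle_exp d.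
Proof.
have h : lift (c + d) - (lift c + lift d) \is a Num.int.
  by apply/angle_eq; rewrite angleD !liftK.
rewrite /circle_exp -(subrK (lift c + lift d) (lift (c + d))) cisD.
by rewrite (cis_int h) mul1r cisD.
Qed.

Lemma circle_exp_eq1 c : circle_exp c = 1 -> c = 0.
Proof. by move/cis_eq1/angle_eq0; rewrite liftK. Qed.

Lemma circle_exp0 : circle_exp 0 = 1.
Proof. by apply: cis_int; apply/angle_eq0; rewrite liftK. Qed.

Definition quarter_arc : set (circle RR) := angle @` [set t | `|t| < 4^-1].

Lemma open_quarter_arc : open quarter_arc.
Proof.
apply: topquot_pi_open.
have -> : [set t : RR | `|t| < 4^-1] = ball 0 4^-1.
  by apply/seteqP; split=> x; rewrite -ball_normE/= sub0r normrN.
exact: ball_open.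
Qed.

Lemma quarter_arc0 : quarter_arc 0.
Proof. by exists 0; rewrite ?angle0//= normr0 invr_gt0. Qed.

(** A representative t of c in ]-1/4, 1/4[ has 2 t in ]-1/2, 1/2[, and 2 t
    differs by an integer of absolute value less than 3/4, that is by 0, from the
    representative of 2 c in ]-1/4, 1/4[. So all the 2^k t stay bounded by 1/4
    and t is 0. *)
Lemma no_small_subgroup (c : circle RR) :
  (forall n, quarter_arc (c *+ n)) -> c = 0.
Proof.
move=> small; have := small 1%N; rewrite mulr1n => -[t /= t4 tc].
have dbl k : `|t *+ 2 ^ k| < 4^-1.
  elim: k => [|k IHk]; first by rewrite expn0 mulr1n.
  have [u /= u4] := small (2 ^ k.+1)%N.
  rewrite -tc -angleMn => /angle_eq/intrP[m me].
  have t2 : t *+ 2 ^ k.+1 = t *+ 2 ^ k + t *+ 2 ^ k.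
    by rewrite expnS mulnC mulrnA mulr2n.
  have m1 : `|m%:~R| < 1 :> RR.
    rewrite -me t2; move: u4 IHk; rewrite !ltr_norml; lra.
  have m0 : m = 0 by move: m1; rewrite -intr_norm ltrz1 => m1; lia.
  by move/eqP: me; rewrite m0 subr_eq0 => /eqP <-.
rewrite -tc; suff -> : t = 0 by exact: angle0.
apply/eqP; apply: contraT => t0; have nt0 : 0 < `|t| by rewrite normr_gt0.
pose k := Num.bound `|t|^-1.
have : 1 <= `|t *+ 2 ^ k|.
  rewrite normrMn -mulr_natr -ler_pdivrMl// mulr1.
  apply/ltW/(lt_trans (archi_boundP _)); first by rewrite invr_ge0.
  by rewrite ltr_nat ltn_expl.
have := dbl k; lra.
Qed.

End Circle.

(** * Orthogonality of characters *)

Section Orthogonality.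
Variables (G : zmodType) (H : zmodClosed G).
Implicit Types (rs : seq G).

(** Representatives of G / H, with the map that sends an element to the
    representative of its coset; sums over the finite group G / H are taken as
    sums over rs. *)
Definition coset_reps rs :=
  uniq rs /\ exists2 rep : G -> G, (forall x, rep x \in rs /\ x - rep x \in H) &
    {in rs, forall r x, x - r \in H -> rep x = r}.

Lemma finite_cover_coset_reps (s : seq G) :
  (forall x, exists2 r, r \in s & x - r \in H) -> exists rs, coset_reps rs.
Proof.
move=> cover; pose rep x := nth 0 s (find (fun r => x - r \in H) s).
have repH x : x - rep x \in H.
  rewrite /rep; have := @nth_find _ 0 (fun r => x - r \in H) s; apply.
  by have [r rs xr] := cover x; apply/hasP; exists r.
have rep_eq x y : x - y \in H -> rep x = rep y.
  move=> xy; rewrite /rep; congr (nth _ _ _); apply: eq_find => r /=.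
  by rewrite -[RHS](rpredDl _ xy) addrA subrK.
exists (undup (map rep s)); split; first exact: undup_uniq.
have reps x : rep x \in undup (map rep s).
  have [r rs xr] := cover x; rewrite mem_undup; apply/mapP; exists r => //.
  by apply: rep_eq.
exists rep => [x //|r]; rewrite mem_undup => /mapP[y ys ->] x xy.
rewrite (rep_eq _ _ xy); apply: rep_eq.
by rewrite -opprB rpredN repH.
Qed.

Lemma sum_coset_reps_shift (F : zmodType) rs (f : G -> F) y :
  coset_reps rs -> (forall x z, x - z \in H -> f x = f z) ->
  \sum_(r <- rs) f (r + y) = \sum_(r <- rs) f r.
Proof.
move=> [urs [rep rep_in repE]] fH.
have inj : {in rs &, injective (fun r => rep (r + y))}.
  move=> r r' rrs r'rs /= e; have [_ h] := rep_in (r + y).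
  have [_ h'] := rep_in (r' + y).
  rewrite -(repE r' r'rs r') ?subrr ?rpred0//; apply/esym/repE => //.
  have := rpredB h' h; rewrite e opprB addrA subrK opprD addrA.
  by rewrite addrAC addrK.
have pe : perm_eq rs (map (fun r => rep (r + y)) rs).
  rewrite perm_sym; apply: uniq_perm => //; first by rewrite map_inj_in_uniq.
  have [||| _ //] := @uniq_min_size _ (map (fun r => rep (r + y)) rs) rs.
  - by rewrite map_inj_in_uniq.
  - by move=> _ /mapP[r _ ->]; have [] := rep_in (r + y).
  - by rewrite size_map.
rewrite [RHS](perm_big _ pe) big_map; apply: eq_bigr => r _.
by apply: fH; have [] := rep_in (r + y).
Qed.

(** Translating the sum by y multiplies it by f y, which is not 1. *)
Lemma sum_nontrivial_character (F : idomainType) rs (f : G -> F) y :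
  coset_reps rs -> {morph f : x z / x + z >-> x * z} ->
  {in H, forall h, f h = 1} -> f y != 1 -> \sum_(r <- rs) f r = 0.
Proof.
move=> trs fD fH fy.
have : \sum_(r <- rs) f (r + y) = \sum_(r <- rs) f r.
  apply: sum_coset_reps_shift => // x z xz.
  by rewrite -(subrK z x) fD fH// mul1r.
under eq_bigr do rewrite fD.
rewrite -mulr_suml => /eqP.
rewrite -subr_eq0 -{2}[\sum_(r <- rs) _]mulr1 -mulrBr.
by rewrite mulf_eq0 subr_eq0 (negPf fy) orbF => /eqP.
Qed.

Variables (C : zmodType) (F : numFieldType) (e : C -> F).
Hypotheses (eD : {morph e : x y / x + y >-> x * y}) (e0 : e 0 = 1)
  (e_inj : forall c, e c = 1 -> c = 0).

(** The double sum of e (phi x - b a x) over representatives a and x is computed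
    in two ways. If phi were none of the b a, each sum over x would be that of a
    nontrivial character and vanish. On the other hand, by nondegeneracy the sum
    over a vanishes unless x is in H, when all its terms are 1; so the double sum
    is the order of G / H, which is not 0 in F. *)
Lemma perfect_pairing rs (b : G -> G -> C) (phi : G -> C) :
  coset_reps rs ->
  (forall a, {morph b a : x y / x + y}) ->
  (forall x, {morph b^~ x : a a' / a + a'}) ->
  (forall a x, x \in H -> b a x = 0) -> (forall a x, a \in H -> b a x = 0) ->
  (forall x, x \notin H -> exists a, b a x != 0) ->
  {morph phi : x y / x + y} -> {in H, forall x, phi x = 0} ->
  exists a, phi =1 b a.
Proof.
move=> trs bDr bDl bHr bHl bnd phiD phiH.
apply/not_existsP => nophi.
pose f a x := e (phi x - b a x).
have fD a : {morph f a : x y / x + y >-> x * y}.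
  by move=> x y; rewrite /f phiD bDr opprD addrACA -eD.
have sum0 a : \sum_(x <- rs) f a x = 0.
  have [y fy] : exists y, f a y != 1.
    apply/not_existsP => h; apply: (nophi a) => y; apply/eqP.
    rewrite -subr_eq0; apply/eqP/e_inj/eqP.
    by apply/negP => /negP; exact: h.
  apply: (@sum_nontrivial_character _ _ _ y) => // x xH.
  by rewrite /f phiH// bHr// subrr.
have : \sum_(a <- rs) \sum_(x <- rs) f a x = 0 by rewrite big1.
(* The representative of the trivial coset is the only one in H. *)
rewrite exchange_big /=.
have [urs [rep rep_in repE]] := trs.
have [r0 r0H] := rep_in 0; rewrite sub0r rpredN in r0H.
rewrite (bigD1_seq (rep 0))//= [X in _ + X]big1_seq ?addr0; last first.
  move=> x /andP[xr0 xrs].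
  have xH : x \notin H.
    apply: contra xr0 => xH; apply/eqP/esym/repE => //.
    by rewrite sub0r rpredN.
  have [a ba] := bnd x xH.
  have ph a' : f a' x = e (phi x) * e (- b a' x) by rewrite /f eD.
  under eq_bigr do rewrite ph.
  rewrite -mulr_sumr.
  rewrite (@sum_nontrivial_character _ _ (fun a => e (- b a x)) a) ?mulr0//.
  - by move=> u v /=; rewrite bDl opprD eD.
  - by move=> h hH; rewrite bHl// oppr0.
  - by apply: contra ba => /eqP/e_inj/eqP; rewrite oppr_eq0.
rewrite (eq_bigr (fun=> 1)) => [|a _]; last by rewrite /f phiH// bHr// subrr.
rewrite big_const_seq count_predT iter_addr addr0 => /eqP.
rewrite pnatr_eq0 size_eq0 => /eqP rs0.
by rewrite rs0 in r0.
Qed.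

End Orthogonality.

(** * The quotient K / R and the ideals of R *)

Section FracQuotient.
Variable R : dvrType.
Local Notation "x %:F" := (@tofrac R x).

Definition cls (x : {fraction R}) : frac_quot R := \pi_(frac_quot R) x.

Lemma clsD x y : cls (x + y) = cls x + cls y.
Proof. exact: topquot_piD. Qed.

Lemma cls_eq0 x : cls x = 0 <-> exists r : R, r%:F = x.
Proof.
have cls0 : cls 0 = 0 by exact: additive0 clsD.
rewrite -cls0; split.
  by move=> /topquot_piE/asboolP; rewrite subr0.
by move=> xR; apply/topquot_piE/asboolP; rewrite subr0.
Qed.

Lemma cls_scale (r : R) x : r *: cls x = cls (r%:F * x).
Proof. exact: frac_quot_scaleE. Qed.

Lemma cls_surj (t : frac_quot R) : exists x, t = cls x.
Proof. by elim/quotW: t => x; exists x. Qed.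

(** The open unit ball of K lies in R, so it collapses to a point in K / R. *)
Lemma frac_quot_discrete (t : frac_quot R) : nbhs t [set t].
Proof.
have [x ->] := cls_surj t.
have nb : nbhs (cls x) (cls @` ball x 1).
  by apply: topquot_pi_nbhs; exact: nbhsx_ballx.
apply: filterS nb => _ [y xy <-].
apply/topquot_piE/asboolP; have [->|yx] := eqVneq y x.
  by exists 0; rewrite subrr tofrac0.
apply/valuation_ge0P; first by rewrite subr_eq0.
move: xy; rewrite ballEmdist/= frac_mdistE -dvr_absN opprB /dvr_abs.
rewrite subr_eq0 (negPf yx) -(expr0z (2 : rat)) ltr_eXz2l ?ltr1n//.
by rewrite oppr_lt0 => /ltW.
Qed.

Lemma uniformizer_exists : exists2 p : R, p != 0 & valuation p%:F = 1.
Proof.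
have [x x0 vx] := @valuation_surj R 1.
have /(valuation_ge0P _ x0)[p px] : 0 <= valuation x by rewrite vx.
by exists p; rewrite ?px// -tofrac_eq0 px.
Qed.

Definition multiples (q : R) : {pred R} := fun x => `[< exists s, x = q * s >].

Lemma multiplesP q x : reflect (exists s, x = q * s) (x \in multiples q).
Proof. exact: asboolP. Qed.

Lemma multiples_zmod_closed q : zmod_closed (multiples q).
Proof.
split; first by apply/multiplesP; exists 0; rewrite mulr0.
move=> x y /multiplesP[s ->] /multiplesP[t ->]; apply/multiplesP.
by exists (s - t); rewrite mulrBr.
Qed.

HB.instance Definition _ q :=
  GRing.isZmodClosed.Build R (multiples q) (multiples_zmod_closed q).

Variable p : R.
Hypotheses (p0 : p != 0) (vp : valuation p%:F = 1).

Let pF0 : p%:F != 0 :> {fraction R}. Proof. by rewrite tofrac_eq0. Qed.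

Lemma valuationXp n : valuation (p%:F ^+ n) = n%:Z.
Proof.
elim: n => [|n IHn]; first by rewrite expr0 valuation1.
by rewrite exprS valuationM ?expf_neq0// IHn vp; lia.
Qed.

Lemma valuationV (x : {fraction R}) : x != 0 -> valuation x^-1 = - valuation x.
Proof.
move=> x0; apply/eqP; rewrite -addr_eq0 -valuationM ?invr_eq0//.
by rewrite mulVf//; apply/eqP; exact: valuation1.
Qed.

(** If t is the class of x, which is not in R, then x has negative valuation and
    1 / (p x) is in R. *)
Lemma frac_quot_socle (t : frac_quot R) :
  t != 0 -> exists s : R, s *: t = cls p%:F^-1.
Proof.
have [x ->] := cls_surj t => tx.
have x0 : x != 0.
  by apply: contra tx => /eqP ->; apply/eqP/cls_eq0; exists 0; exact: tofrac0.
have vx : ~ 0 <= valuation x.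
  by move=> /(valuation_ge0P _ x0)/cls_eq0 xR; rewrite xR eqxx in tx.
have px0 : p%:F^-1 / x != 0 by rewrite mulf_neq0 ?invr_eq0.
have /(valuation_ge0P _ px0)[s sx] : 0 <= valuation (p%:F^-1 / x).
  rewrite valuationM ?invr_eq0// !valuationV// vp; lia.
by exists s; rewrite cls_scale sx divfK.
Qed.

Lemma frac_quot_torsion (t : frac_quot R) : exists n, p ^+ n *: t = 0.
Proof.
have [x ->] := cls_surj t; have [->|x0] := eqVneq x 0.
  by exists 0; rewrite cls_scale mulr0; apply/cls_eq0; exists 0; exact: tofrac0.
exists `|valuation x|%N; rewrite cls_scale; apply/cls_eq0.
apply/valuation_ge0P; rewrite tofracXn ?mulf_neq0 ?expf_neq0//.
by rewrite valuationM ?expf_neq0// valuationXp; lia.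
Qed.

Lemma scale_cls_pVn_eq0 n (z : R) :
  z *: cls (p%:F ^- n) = 0 <-> z \in multiples (p ^+ n).
Proof.
have pn0 : p%:F ^+ n != 0 :> {fraction R} by rewrite expf_neq0.
rewrite cls_scale; split=> [/cls_eq0[s sz]|/multiplesP[s ->]].
  apply/multiplesP; exists s; apply/eqP.
  by rewrite -tofrac_eq tofracM sz tofracXn mulrCA divff ?mulr1.
by apply/cls_eq0; exists s; rewrite tofracM tofracXn mulrAC divff ?mul1r.
Qed.

Lemma nbhs_adic_coset n (x : adic R) :
  nbhs x [set y : adic R | (y - x : R) \in multiples (p ^+ n)].
Proof.
apply/(nbhs_adicP _ _ p0 vp); exists n => s; apply/multiplesP; exists s.
by rewrite /= addrC addKr.
Qed.

Lemma open_adic_coset n (r : adic R) :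
  open [set y : adic R | (y - r : R) \in multiples (p ^+ n)].
Proof.
rewrite openE => x /= xr; apply: filterS (nbhs_adic_coset n x) => y /= yx.
by have := rpredD yx xr; rewrite addrA subrK.
Qed.

Lemma closed_adic_coset n (r : adic R) :
  closed [set y : adic R | (y - r : R) \in multiples (p ^+ n)].
Proof.
rewrite -[X in closed X]setCK closedC openE => x /= xr.
apply: filterS (nbhs_adic_coset n x) => y /= yx yr; apply: xr.
by have := rpredB yr yx; rewrite opprB addrC addrA subrK.
Qed.

(* The equivalence of compactness with the finite subcover property is stated
   for pointed spaces. *)
HB.instance Definition _ := isPointed.Build (adic R) 0.

(** The cosets of p^n R form an open cover of R. *)
Lemma compact_coset_reps n : compact [set: adic R] ->
  exists rs, coset_reps (multiples (p ^+ n)) rs.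
Proof.
rewrite compact_cover => cR.
have [||s _ sc] := cR (adic R) setT
  (fun r => [set y : adic R | (y - r : R) \in multiples (p ^+ n)]).
- by move=> r _; exact: open_adic_coset.
- by move=> x _; exists x => //=; rewrite subrr rpred0.
have := @finite_cover_coset_reps R (multiples (p ^+ n)) (finmap.enum_fset s).
apply=> x; by have [r /= rs xr] := sc x I; exists r.
Qed.

End FracQuotient.

(** * The Pontryagin dual of R *)

Section Characters.
Variables (RR : realType) (R : dvrType) (p : R).
Hypotheses (p0 : p != 0) (vp : valuation (@tofrac R p) = 1).

Lemma additive_small_eq0 q (f : R -> circle RR) : {morph f : x y / x + y} ->
  (forall x, x \in multiples q -> quarter_arc (f x)) ->
  forall x, x \in multiples q -> f x = 0.
Proof.
move=> fD small x xq; apply: no_small_subgroup => n.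
by rewrite -additiveMn//; apply: small; exact: rpredMn.
Qed.

(** By continuity phi maps some p^n R into the quarter arc, and the image of this
    subgroup is a subgroup. *)
Lemma character_conductor (phi : pdual RR R) :
  exists n, forall x : R, x \in multiples (p ^+ n) -> phi x = 0.
Proof.
have nb : nbhs (0 : adic R) (phi @^-1` @quarter_arc RR).
  apply: pdual_continuous; apply: open_nbhs_nbhs.
  split; first exact: open_quarter_arc.
  by rewrite (additive0 (pdualD phi)); exact: quarter_arc0.
have [n small] := (nbhs_adicP 0 _ p0 vp).1 nb; exists n.
apply: additive_small_eq0; first exact: pdualD.
by move=> _ /multiplesP[s ->]; have := small s; rewrite add0r.
Qed.

(** Let phi be constant on the finitely many cosets K r of p^n R. These are
    compact, so requiring g to map each K r into the arc of center phi r defines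
    a neighborhood of phi. For such a g the character g - phi takes its values
    in the quarter arc, hence is 0. *)
Lemma pdual_discrete (phi : pdual RR R) : compact [set: adic R] ->
  nbhs phi [set phi].
Proof.
move=> cR; have [n phin] := character_conductor phi.
have [rs [_ [rep rep_in _]]] := compact_coset_reps p0 vp n cR.
pose K (r : adic R) := [set y : adic R | (y - r : R) \in multiples (p ^+ n)].
have cK r : compact (K r).
  by apply: subclosed_compact cR _ => //; exact: closed_adic_coset.
pose O (r : adic R) := (fun c => - phi r + c) @^-1` @quarter_arc RR.
have oO r : open (O r).
  have /continuousP := @addl_continuous (circle RR) (- phi r).
  by apply; exact: open_quarter_arc.
have phiE (x r : adic R) : K r x -> phi x = phi r.
  move=> xr; rewrite -[x in LHS](subrK r) pdualD.
  by rewrite (phin (x - r)) ?add0r.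
pose Q (r : adic R) := [set g : pdual RR R | pdual_fun g @` K r `<=` O r].
have nQ r : nbhs phi (Q r).
  have : nbhs (val phi : {compact-open, adic R -> circle RR})
      [set g | g @` K r `<=` O r].
    apply: open_nbhs_nbhs; split; first exact: compact_open_open.
    move=> _ [x /phiE xr <-]; rewrite /O /=.
    have -> : val phi x = phi r by exact: xr.
    by rewrite addNr; exact: quarter_arc0.
  exact: (@initial_continuous _ _
    (set_val : pdual RR R -> {compact-open, adic R -> circle RR})).
suff only_phi (g : pdual RR R) : {in rs, forall r, Q r g} -> g = phi.
  by apply: filterS (nbhs_all_seq rs nQ) => g; exact: only_phi.
move=> gQ.
have small (x : R) : quarter_arc (g x - phi x).
  have [rrs xr] := rep_in x.
  have := gQ (rep x) rrs (g x); rewrite /O /= addrC.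
  rewrite (phiE _ _ xr); apply; by exists x.
apply: pdualP => x; apply/eqP; rewrite -subr_eq0; apply/eqP.
have x1 : (x : R) \in multiples 1 by apply/multiplesP; exists x; rewrite mul1r.
apply: (@additive_small_eq0 1 (fun x : R => g x - phi x) _ _ x x1) => [y z|//].
by rewrite !pdualD opprD addrACA.
Qed.

Section CharacterOfScaling.
Variable psi : frac_quot R -> circle RR.
Hypotheses (psiD : {morph psi : x y / x + y})
  (psi_socle : psi (cls (@tofrac R p)^-1) != 0).

Lemma scaling_character_continuous (t : frac_quot R) :
  continuous (fun s : adic R => psi ((s : R) *: t)).
Proof.
move=> s A nA; have [n tn] := frac_quot_torsion p0 vp t.
apply/(nbhs_adicP _ _ p0 vp); exists n => u /=.
by rewrite scalerDl mulrC -scalerA tn scaler0 addr0; exact: nbhs_singleton nA.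
Qed.

Lemma scaling_characterD (t : frac_quot R) :
  {morph (fun s : adic R => psi ((s : R) *: t)) : x y / x + y}.
Proof. by move=> x y; rewrite -psiD -scalerDl. Qed.

Definition scaling_character (t : frac_quot R) : pdual RR R :=
  mkdual (@scaling_character_continuous t) (scaling_characterD t).

Lemma scaling_characterE t (s : R) : scaling_character t s = psi (s *: t).
Proof. by []. Qed.

Lemma scaling_character_linear : linear scaling_character.
Proof.
move=> a t u; apply: pdualP => s.
rewrite pdual_addE pdual_scaleE !scaling_characterE scalerDr psiD scalerA.
by rewrite mulrC.
Qed.

(** The kernel of psi contains no nonzero R-submodule, as each of these contains
    the class of 1 / p. *)
Lemma scaling_character_eq0 t : (forall s : R, psi (s *: t) = 0) -> t = 0.
Proof.
move=> t0; apply/eqP; apply: contraT => /(frac_quot_socle p0 vp)[s st].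
by have := psi_socle; rewrite -st t0 eqxx.
Qed.

Lemma scaling_character_inj : injective scaling_character.
Proof.
move=> t u tu; apply/eqP; rewrite -subr_eq0; apply/eqP.
apply: scaling_character_eq0 => s; rewrite scalerBr psiD.
have := congr1 (fun f : pdual RR R => f s) tu => /=.
rewrite !scaling_characterE => ->.
by rewrite -psiD -scalerBr subrr scaler0 additive0.
Qed.

(** If phi vanishes on p^n R and t is the class of 1 / p^n, then phi is the
    character of some multiple a t: the pairing (a, x) |-> psi (a x t) satisfies
    the hypotheses of perfect_pairing, its nondegeneracy being
    scaling_character_eq0 applied to x t. *)
Lemma scaling_character_surj : compact [set: adic R] ->
  forall phi, exists t, scaling_character t = phi.
Proof.
move=> cR phi; have [n phin] := character_conductor phi.
have [rs rsP] := compact_coset_reps p0 vp n cR.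
pose t := cls ((@tofrac R p) ^- n).
have psi0 : psi 0 = 0 by exact: additive0.
have kill (z : R) : z *: t = 0 <-> z \in multiples (p ^+ n).
  exact: scale_cls_pVn_eq0.
suff [a phia] : exists a : R, forall x : R, phi x = psi ((a * x) *: t).
  exists (a *: t); apply: pdualP => s.
  by rewrite (phia s) scaling_characterE scalerA mulrC.
apply: (perfect_pairing (@circle_expD RR) (circle_exp0 RR)
  (@circle_exp_eq1 RR) rsP (b := fun a x => psi ((a * x) *: t))
  (phi := phi : R -> circle RR)).
- by move=> a x y; rewrite mulrDr scalerDl psiD.
- by move=> x a b; rewrite mulrDl scalerDl psiD.
- by move=> a x /kill xt; rewrite -scalerA xt scaler0.
- by move=> a x /kill xt; rewrite mulrC -scalerA xt scaler0.
- move=> x xn; apply/not_existsP => h; move/negP: xn; apply; apply/kill.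
  apply: scaling_character_eq0 => s; rewrite scalerA; apply/eqP.
  by apply/negP => /negP; exact: h.
- exact: pdualD.
- exact: phin.
Qed.

End CharacterOfScaling.
End Characters.

Theorem theorem2p8 (RR : realType) (R : dvrType)
    (cR : compact [set: adic R]) :
  exists2 f : {linear pdual RR R -> frac_quot R}, continuous f &
    exists g : frac_quot R -> pdual RR R,
      [/\ cancel f g, cancel g f & continuous g].
Proof.
have [p p0 vp] := uniformizer_exists R.
have socle0 : cls (@tofrac R p)^-1 != 0.
  have pF0 : @tofrac R p != 0 by rewrite tofrac_eq0.
  apply/eqP => /cls_eq0 /(valuation_ge0P _ (invr_neq0 pF0)).
  by rewrite valuationV// vp.
have [psi psiD psi_socle] := separating_hom
  (@circle_divisible RR) (@circle_torsion RR) socle0.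
pose g := scaling_character p0 vp psiD.
have [f fg] := choice (scaling_character_surj p0 vp psiD psi_socle cR).
have gf : cancel g f.
  by move=> t; apply: (scaling_character_inj psi_socle); exact: fg.
pose gl := GRing.isLinear.Build _ _ _ _ g (scaling_character_linear p0 vp psiD).
pose G : {linear frac_quot R -> pdual RR R} := HB.pack g gl.
have fl : linear f by exact: (@can2_linear _ _ _ G f).
pose fm := GRing.isLinear.Build _ _ _ _ f fl.
pose F : {linear pdual RR R -> frac_quot R} := HB.pack f fm.
exists F.
  by apply: discrete_continuous => phi; exact: (@pdual_discrete RR R p).
exists g; split=> //.
by apply: discrete_continuous => t; exact: frac_quot_discrete.
Qed.
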